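(* Fix $\theta_1<\theta_2<\theta_1+2\pi$ and denote $\theta=\theta_2-\theta_1$. (1) For fixed $\mu\in\mathbb R$, $$\lim_{\kappa\to0+}\kappa\log\mathcal G_\mu(\theta_1,\theta_2)=2\log\sin\big((\theta_2-\theta_1)/2\big)+\mu(\theta_1+\theta_2).$$ (2) If $\alpha=\alpha(\kappa)<1-\kappa/8$ satisfies $\alpha\sim-\lambda/\kappa$ as $\kappa\to0+$ for some $\lambda\ge0$, then the limit $$\mathcal U^\lambda(\theta)=\lim_{\kappa\to0+}\kappa\log\mathcal Z_\alpha(\theta_1,\theta_2)$$ exists, and for $\theta\in(0,\pi]$, $$\mathcal U^\lambda(\theta)=\mathcal U^\lambda(2\pi-\theta)=-2\log\sin(\theta/2)+\int_\theta^\pi\sqrt{2\lambda+4\cot^2(u/2)}\,du.$$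
   Context: For $\kappa\in(0,8)$, $\mu\in\mathbb R$ and $\theta_1<\theta_2<\theta_1+2\pi$, $$\mathcal G_\mu(\theta_1,\theta_2)=\big(\sin((\theta_2-\theta_1)/2)\big)^{2/\kappa}\exp\Big(\tfrac\mu\kappa(\theta_1+\theta_2)\Big).$$ For $\kappa\in(0,8)$ and $\alpha<1-\kappa/8$, $$\mathcal Z_\alpha(\theta_1,\theta_2)=\big(\sin((\theta_2-\theta_1)/2)\big)^{(\kappa-6)/\kappa}\phi_\alpha\Big(\big(\sin((\theta_2-\theta_1)/4)\big)^2\Big),$$ where $\phi_\alpha$ is the unique solution (positive on $(0,1)$) of $u(1-u)\phi''(u)-\frac{3\kappa-8}{2\kappa}(2u-1)\phi'(u)+\frac{8\alpha}\kappa\phi(u)=0$, $u\in(0,1)$, with $\phi(1/2)=1$, $\phi'(1/2)=0$. Both functions depend on $\kappa$. The notation $\alpha\sim-\lambda/\kappa$ means $\alpha(\kappa)=-\frac\lambda\kappa(1+o(1))$ as $\kappa\to0+$. *)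

(* Defs.v *)
From Stdlib Require Import Reals ClassicalEpsilon.
From Coquelicot Require Import Coquelicot.
Open Scope R_scope.

Definition cot (x : R) : R := cos x / sin x.

Definition calG (kappa mu theta1 theta2 : R) : R :=
  Rpower (sin ((theta2 - theta1) / 2)) (2 / kappa)
  * exp (mu / kappa * (theta1 + theta2)).

Definition phi_solution (kappa alpha : R) (phi : R -> R) : Prop :=
  (forall u, 0 < u < 1 -> ex_derive phi u /\ ex_derive (Derive phi) u) /\
  (forall u, 0 < u < 1 ->
     u * (1 - u) * Derive_n phi 2 u
     - (3 * kappa - 8) / (2 * kappa) * (2 * u - 1) * Derive phi u
     + 8 * alpha / kappa * phi u = 0) /\
  phi (1 / 2) = 1 /\
  Derive phi (1 / 2) = 0 /\
  (forall u, 0 < u < 1 -> 0 < phi u).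

(* For 0 < kappa < 8 and alpha < 1 - kappa / 8 a solution exists and any two
   solutions agree on (0, 1), so [epsilon] picks the solution; its values
   outside (0, 1) are irrelevant, since sin ((theta2 - theta1) / 4) ^ 2 lies in
   (0, 1) when theta1 < theta2 < theta1 + 2 PI. *)
Definition phi (kappa alpha : R) : R -> R :=
  epsilon (inhabits (fun _ : R => 0)) (phi_solution kappa alpha).

Definition calZ (kappa alpha theta1 theta2 : R) : R :=
  Rpower (sin ((theta2 - theta1) / 2)) ((kappa - 6) / kappa)
  * phi kappa alpha (sin ((theta2 - theta1) / 4) ^ 2).

(* alpha(kappa) = - (lambda / kappa) * (1 + o(1)) as kappa -> 0+. When
   lambda = 0 this says that alpha vanishes for all small kappa > 0; it is
   strictly stronger than kappa * alpha(kappa) -> 0. *)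
Definition alpha_equiv (lambda : R) (alpha : R -> R) : Prop :=
  is_equiv (at_right 0) (fun kappa => - (lambda / kappa)) alpha.

(* Main.v *)
(** Put [theta = PI - s], [t = tan (s / 2)] and [l = - 2 alpha kappa], so that
    [l -> 2 lambda].  Then [h s = phi (sin (theta / 4) ^ 2)] satisfies
    [kappa ^ 2 h'' = - kappa (4 - kappa) t h' + l h] with [h 0 = 1], [h' 0 = 0],
    and so does [s |-> h (- s)]; both halves of [0 < theta < 2 PI] thus reduce
    to [0 <= s < PI].  The logarithmic derivative [P = kappa h' / h] solves the
    Riccati equation [kappa P' = - P ^ 2 - (4 - kappa) t P + l], whose stable
    equilibrium tends to [Q = sqrt (4 t ^ 2 + 2 lambda) - 2 t].  Replacing
    [2 lambda] by [nu > 2 lambda] or [nu < 2 lambda] makes [Q] a super- or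
    subsolution for small [kappa], and comparison squeezes [kappa ln h] to the
    integral of [Q], up to an initial layer of size [O(kappa)] since [P 0 = 0].
    Since [l >= 0] for small [kappa], [alpha <= 0] there, and a solution [phi]
    exists as a power series in [(2 u - 1) ^ 2] of radius at least 1; it is
    positive because [h ^ 2] is nondecreasing away from [s = 0]. *)

Require Import Defs.
From Stdlib Require Import Reals Ranalysis5 Lra Lia ClassicalEpsilon.
From Coquelicot Require Import Coquelicot.
Open Scope R_scope.

(** * Power series solutions of the equation for [phi] *)

(* Recurrence of the even solutions [f x = g (x ^ 2)] of
   [(1 - x ^ 2) f'' + (d - 1) x f' - b f = 0], where [x = 2 u - 1]. *)
Fixpoint hyp_coef (d b : R) (k : nat) : R :=
  match k with
  | O => 1
  | S j => (4 * INR j ^ 2 - 2 * d * INR j + b)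
           / ((2 * INR j + 2) * (2 * INR j + 1)) * hyp_coef d b j
  end.

Lemma eventually_nonincreasing_bounded (f : nat -> R) (N : nat) :
  (forall k, (N <= k)%nat -> f (S k) <= f k) -> exists M, forall k, f k <= M.
Proof.
  intros Hf.
  assert (Hinit : forall n, exists M, forall k, (k <= n)%nat -> f k <= M).
  { induction n as [|n [M HM]].
    - exists (f 0%nat). intros k Hk. replace k with 0%nat by lia. apply Rle_refl.
    - exists (Rmax M (f (S n))). intros k Hk.
      destruct (Nat.eq_dec k (S n)) as [->|Hne]; [apply Rmax_r|].
      eapply Rle_trans; [apply HM; lia | apply Rmax_l]. }
  destruct (Hinit N) as [M HM]. exists M. intros k.
  destruct (Nat.le_ge_cases k N) as [Hk|Hk]; [now apply HM|].
  induction Hk as [|k Hk IH]; [now apply HM|].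
  eapply Rle_trans; [now apply Hf | exact IH].
Qed.

(** The ratio of consecutive terms tends to [r < 1] in absolute value, so from some index on the
    absolute values do not increase. *)
Lemma hyp_coef_bounded (d b r : R) : 0 < r < 1 ->
  exists M, forall k, Rabs (hyp_coef d b k * r ^ k) <= M.
Proof.
  intros Hr.
  set (D := Rabs d). set (B := Rabs b).
  assert (HD : 0 <= D) by apply Rabs_pos.
  assert (HB : 0 <= B) by apply Rabs_pos.
  (* For [x >= N + 1] this choice gives [2 D + B <= 4 (1 - r) x], hence [(4 x ^ 2 + 2 D x + B) r <=
     4 x ^ 2 <= den]. *)
  destruct (nfloor_ex ((2 * D + B) / (4 * (1 - r)))) as [N [_ HN]].
  { apply Rdiv_le_0_compat; lra. }
  apply (eventually_nonincreasing_bounded _ (S N)).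
  intros k Hk. rewrite <- tech_pow_Rmult. cbn [hyp_coef].
  set (x := INR k).
  assert (Hx : INR N + 1 <= x).
  { unfold x. rewrite <- S_INR. now apply le_INR. }
  assert (HN0 := pos_INR N).
  assert (H1 : (2 * D + B) <= 4 * (1 - r) * x).
  { apply Rlt_div_l in HN; [|lra]. nra. }
  set (den := (2 * x + 2) * (2 * x + 1)).
  assert (Hden : 0 < den) by (unfold den; nra).
  set (num := 4 * x ^ 2 - 2 * d * x + b).
  assert (Hnum : Rabs num <= 4 * x ^ 2 + 2 * D * x + B).
  { unfold num, D, B. apply Rabs_le.
    assert (Hd1 := Rle_abs d). assert (Hd2 := Rle_abs (- d)).
    assert (Hb1 := Rle_abs b). assert (Hb2 := Rle_abs (- b)).
    rewrite Rabs_Ropp in Hd2, Hb2. split; nra. }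
  replace (num / den * hyp_coef d b k * (r * r ^ k))
    with (num / den * r * (hyp_coef d b k * r ^ k)) by ring.
  rewrite (Rabs_mult (num / den * r)).
  rewrite <- (Rmult_1_l (Rabs (hyp_coef d b k * r ^ k))) at 2.
  apply Rmult_le_compat_r; [apply Rabs_pos|].
  rewrite Rabs_mult, (Rabs_pos_eq r) by lra.
  unfold Rdiv. rewrite Rabs_mult, Rabs_inv, (Rabs_pos_eq den) by lra.
  apply (Rmult_le_reg_r den); [exact Hden|].
  replace (Rabs num * / den * r * den) with (Rabs num * r) by (field; lra).
  apply Rle_trans with ((4 * x ^ 2 + 2 * D * x + B) * r).
  - apply Rmult_le_compat_r; lra.
  - assert (0 <= 2 * D * x + B) by nra.
    assert ((2 * D * x + B) * r <= 2 * D * x + B) by nra.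
    assert (2 * D * x + B <= (2 * D + B) * x) by nra.
    assert ((2 * D + B) * x <= 4 * (1 - r) * x * x) by nra.
    unfold den. nra.
Qed.

Lemma hyp_coef_CV_radius (d b v : R) : Rabs v < 1 ->
  Rbar_lt (Rabs v) (CV_radius (hyp_coef d b)).
Proof.
  intros Hv.
  assert (H0 := Rabs_pos v).
  set (r := (Rabs v + 1) / 2).
  apply Rbar_lt_le_trans with (Finite r); [simpl; unfold r; lra|].
  apply (proj1 (CV_radius_bounded (hyp_coef d b))).
  apply hyp_coef_bounded. unfold r; lra.
Qed.

Definition hyp (d b : R) : R -> R := PSeries (hyp_coef d b).
Definition hyp1 (d b : R) : R -> R := PSeries (PS_derive (hyp_coef d b)).
Definition hyp2 (d b : R) : R -> R :=
  PSeries (PS_derive (PS_derive (hyp_coef d b))).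

Lemma hyp_0 (d b : R) : hyp d b 0 = 1.
Proof. unfold hyp. now rewrite PSeries_0. Qed.

Lemma is_derive_hyp (d b v : R) : Rabs v < 1 ->
  is_derive (hyp d b) v (hyp1 d b v).
Proof. intros Hv. now apply is_derive_PSeries, hyp_coef_CV_radius. Qed.

Lemma is_derive_hyp1 (d b v : R) : Rabs v < 1 ->
  is_derive (hyp1 d b) v (hyp2 d b v).
Proof.
  intros Hv. apply is_derive_PSeries. rewrite CV_radius_derive.
  now apply hyp_coef_CV_radius.
Qed.

(** For [f x = g (x ^ 2)] one has [f' = 2 x g'] and [f'' = 2 g' + 4 x ^ 2 g''], which turns the
    equation for [f] into this one in [v = x ^ 2]. *)
Lemma hyp_ode (d b v : R) : Rabs v < 1 ->
  4 * v * (1 - v) * hyp2 d b v + (2 + (2 * d - 4) * v) * hyp1 d b v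
  - b * hyp d b v = 0.
Proof.
  intros Hv.
  set (e := hyp_coef d b). set (e1 := PS_derive e). set (e2 := PS_derive e1).
  assert (Ev : ex_pseries e v) by now apply CV_radius_inside, hyp_coef_CV_radius.
  assert (E1 : ex_pseries e1 v).
  { apply CV_radius_inside. unfold e1. rewrite CV_radius_derive.
    now apply hyp_coef_CV_radius. }
  assert (E2 : ex_pseries e2 v).
  { apply CV_radius_inside. unfold e2, e1. rewrite !CV_radius_derive.
    now apply hyp_coef_CV_radius. }
  (* The left side as one series, with multiplication by [v] as an index shift. The recurrence kills
     every coefficient; shifts by up to two single out [n = 0] and [n = 1]. *)
  set (S := PS_plus
    (PS_plus (PS_scal 4 (PS_incr_1 e2)) (PS_scal (-4) (PS_incr_1 (PS_incr_1 e2))))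
    (PS_plus (PS_plus (PS_scal 2 e1) (PS_scal (2 * d - 4) (PS_incr_1 e1)))
       (PS_scal (- b) e))).
  assert (HS : PSeries S v = 0).
  { rewrite <- (PSeries_const_0 v). apply PSeries_ext. intros n.
    unfold S, PS_plus, PS_scal, PS_incr_1, e2, e1, PS_derive, plus, scal, zero.
    cbn -[INR hyp_coef]. unfold mult. cbn -[INR hyp_coef]. unfold e.
    destruct n as [|[|n]]; cbn [hyp_coef]; rewrite ?S_INR; simpl INR.
    - field.
    - field.
    - assert (H := pos_INR n). field. lra. }
  rewrite <- HS. unfold S.
  rewrite !PSeries_plus.
  - rewrite !PSeries_scal, !PSeries_incr_1. unfold hyp, hyp1, hyp2. fold e e1 e2.
    ring.
  all: repeat match goal with
    | H : ex_pseries ?a ?x |- ex_pseries ?a ?x => exact H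
    | |- ex_pseries (PS_plus _ _) _ => apply ex_pseries_plus
    | |- ex_pseries (PS_scal _ _) _ => apply ex_pseries_scal; [apply Rmult_comm|]
    | |- ex_pseries (PS_incr_1 _) _ => apply (ex_pseries_incr_1 (V := R_NormedModule))
    end.
Qed.

(** * Calculus tools and the function [tan (s / 2)] *)

(** [auto_derive] leaves [Derive] of abstract functions in its result; the [is_derive] hypotheses in
    context supply their values. *)
Ltac subst_Derive :=
  repeat match goal with
  | H : is_derive ?f ?x ?l |- context [Derive ?g ?x] =>
      replace (Derive g x) with l by (symmetry; exact (is_derive_unique f x l H))
  end.

Lemma derive_nonneg_le (f df : R -> R) (a b : R) : a <= b ->
  (forall x, a <= x <= b -> is_derive f x (df x)) ->
  (forall x, a <= x <= b -> 0 <= df x) -> f a <= f b.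
Proof.
  intros Hab Hd Hpos.
  destruct (MVT_gen f a b df) as [c [Hc Heq]];
    rewrite ?Rmin_left, ?Rmax_right in * by lra.
  - intros x Hx. apply Hd; lra.
  - intros x Hx. apply continuity_pt_filterlim, (ex_derive_continuous f).
    eexists. now apply Hd.
  - assert (H := Hpos c Hc). nra.
Qed.

Definition tan_half (s : R) : R := sin (s / 2) / cos (s / 2).

Lemma cos_half_pos (s : R) : - PI < s < PI -> 0 < cos (s / 2).
Proof. intros Hs. apply cos_gt_0; lra. Qed.

Lemma is_derive_tan_half (s : R) : - PI < s < PI ->
  is_derive tan_half s ((1 + tan_half s ^ 2) / 2).
Proof.
  intros Hs. assert (Hc := cos_half_pos s Hs). unfold tan_half.
  auto_derive; [lra|].
  change (s * / 2) with (s / 2). field. exact (Rgt_not_eq _ _ Hc).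
Qed.

Lemma tan_half_nonneg (s : R) : 0 <= s < PI -> 0 <= tan_half s.
Proof.
  intros Hs. unfold tan_half.
  apply Rdiv_le_0_compat; [apply sin_ge_0; lra | apply cos_half_pos; lra].
Qed.

Lemma tan_half_le (s s0 : R) : 0 <= s <= s0 -> s0 < PI ->
  tan_half s <= tan_half s0.
Proof.
  intros Hs Hs0.
  apply (derive_nonneg_le _ (fun x => (1 + tan_half x ^ 2) / 2)); [lra| |].
  - intros x Hx. apply is_derive_tan_half; lra.
  - intros x _. assert (H := pow2_ge_0 (tan_half x)). lra.
Qed.

(** * The equation in the angular variable and positivity of its solutions *)

Definition radial_ode (kappa l : R) (h h1 : R -> R) : Prop :=
  h 0 = 1 /\ h1 0 = 0 /\
  forall s, - PI < s < PI ->
    is_derive h s (h1 s) /\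
    is_derive h1 s ((1 - 4 / kappa) * tan_half s * h1 s + l / kappa ^ 2 * h s).

(** The power [cos (s / 2) ^ (2 (1 - 4 / kappa))], an integrating factor that absorbs the
    first-order term of [radial_ode]. *)
Definition damping (kappa s : R) : R :=
  exp ((1 - 4 / kappa) * (2 * ln (cos (s / 2)))).

Lemma is_derive_damping (kappa s : R) : - PI < s < PI ->
  is_derive (damping kappa) s
    (- (1 - 4 / kappa) * tan_half s * damping kappa s).
Proof.
  intros Hs. assert (Hc := cos_half_pos s Hs).
  unfold damping, tan_half. auto_derive; [lra|].
  change (s * / 2) with (s / 2). set (a := 1 - 4 / kappa). field. exact (Rgt_not_eq _ _ Hc).
Qed.

Lemma damping_0 (kappa : R) : damping kappa 0 = 1.
Proof.
  unfold damping. replace (0 / 2) with 0 by field.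
  rewrite cos_0, ln_1, !Rmult_0_r. apply exp_0.
Qed.

Lemma ln_le_0 (x : R) : 0 < x <= 1 -> ln x <= 0.
Proof. intros Hx. rewrite <- ln_1. apply ln_le; lra. Qed.

Lemma damping_ge_1 (kappa s : R) : 0 < kappa < 4 -> - PI < s < PI ->
  1 <= damping kappa s.
Proof.
  intros Hk Hs. unfold damping.
  assert (Hl : ln (cos (s / 2)) <= 0).
  { apply ln_le_0. split; [now apply cos_half_pos | apply COS_bound]. }
  assert (Hq : 1 <= 4 / kappa) by (apply Rle_div_r; lra).
  set (y := (1 - 4 / kappa) * (2 * ln (cos (s / 2)))).
  assert (0 <= y) by (unfold y; nra).
  assert (He := exp_ineq1_le y). lra.
Qed.

(* [(damping h h1)' = damping (h1 ^ 2 + l / kappa ^ 2 h ^ 2) >= 0], so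
   [h ^ 2] is nondecreasing. *)
Lemma radial_ode_ge_1 (kappa l : R) (h h1 : R -> R) (s : R) :
  0 < kappa -> 0 <= l -> radial_ode kappa l h h1 -> 0 <= s < PI -> 1 <= h s.
Proof.
  intros Hk Hl (H0 & H10 & Hode) Hs.
  assert (Hl2 : 0 <= l / kappa ^ 2).
  { apply Rdiv_le_0_compat; [lra | apply pow_lt; lra]. }
  assert (Hprod : forall x, 0 <= x < PI -> 0 <= h x * h1 x).
  { intros x Hx.
    assert (Hle : damping kappa 0 * h 0 * h1 0 <= damping kappa x * h x * h1 x).
    { apply (derive_nonneg_le (fun x => damping kappa x * h x * h1 x)
        (fun x => damping kappa x * (h1 x ^ 2 + l / kappa ^ 2 * h x ^ 2)));
        [lra| |].
      - intros y Hy. destruct (Hode y) as [D1 D2]; [lra|].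
        assert (D0 : is_derive (damping kappa) y _)
          by (apply is_derive_damping; lra).
        auto_derive; [repeat split; eexists; eassumption|].
        subst_Derive.
        ring.
      - intros y _. apply Rmult_le_pos; [left; apply exp_pos|].
        assert (A1 := pow2_ge_0 (h1 y)). assert (A2 := pow2_ge_0 (h y)). nra. }
    rewrite H10, Rmult_0_r in Hle.
    assert (Hpos : 0 < damping kappa x) by apply exp_pos.
    rewrite Rmult_assoc in Hle.
    apply (Rmult_le_reg_l (damping kappa x)); lra. }
  assert (Hsq : forall x, 0 <= x < PI -> 1 <= h x * h x).
  { intros x Hx.
    replace 1 with (h 0 * h 0) by (rewrite H0; ring).
    apply (derive_nonneg_le (fun x => h x * h x) (fun x => 2 * (h x * h1 x)));
      [lra| |].
    - intros y Hy. destruct (Hode y) as [D1 _]; [lra|].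
      auto_derive; [repeat split; eexists; eassumption|].
      subst_Derive. ring.
    - intros y Hy. assert (A := Hprod y ltac:(lra)). lra. }
  (* [h ^ 2 >= 1] leaves the sign open, but a negative value would force a zero of [h] between [0]
     and [s]. *)
  destruct (Rlt_le_dec (h s) 0) as [Hneg|Hpos].
  - exfalso.
    destruct (IVT_interv (fun x => - h x) 0 s) as [z [Hz Hhz]].
    + intros x Hx. apply continuity_pt_opp, continuity_pt_filterlim.
      apply (ex_derive_continuous h). destruct (Hode x) as [D1 _]; [lra|].
      eexists; exact D1.
    + destruct (Req_dec s 0) as [->|Hne]; lra.
    + lra.
    + lra.
    + assert (A := Hsq z ltac:(lra)). assert (B : h z = 0) by lra.
      rewrite B in A. lra.
  - assert (A := Hsq s Hs). nra.
Qed.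

(** * Comparison with super- and subsolutions of the Riccati equation *)

(* [V = (Q h - kappa h1) exp (W / kappa) damping] is the Wronskian of
   [exp (W / kappa)] and [h], up to an integrating factor. *)
Lemma is_derive_wronskian (kappa l : R) (h h1 W Q : R -> R) (s dQ : R) :
  0 < kappa -> radial_ode kappa l h h1 -> - PI < s < PI ->
  is_derive W s (Q s) -> is_derive Q s dQ ->
  is_derive
    (fun x => (Q x * h x - kappa * h1 x) * exp (W x / kappa) * damping kappa x) s
    (h s / kappa * exp (W s / kappa) * damping kappa s
     * (Q s ^ 2 + (4 - kappa) * tan_half s * Q s + kappa * dQ - l)).
Proof.
  intros Hk (_ & _ & Hode) Hs DW DQ.
  destruct (Hode s Hs) as [D1 D2].
  assert (D0 := is_derive_damping kappa s Hs).
  auto_derive; [repeat split; eexists; eassumption|].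
  subst_Derive.
  change (W s * / kappa) with (W s / kappa). field. lra.
Qed.

(** For a supersolution [Q] the Wronskian expression is nondecreasing and starts at [Q 0 >= 0], so
    [kappa h1 / h <= Q = W']; integrating from [0] gives the bound. *)
Lemma radial_ode_upper (kappa l s0 : R) (h h1 W Q dQ : R -> R) :
  0 < kappa -> 0 <= l -> radial_ode kappa l h h1 -> 0 <= s0 < PI ->
  (forall s, 0 <= s <= s0 -> is_derive W s (Q s) /\ is_derive Q s (dQ s)) ->
  W 0 = 0 -> 0 <= Q 0 ->
  (forall s, 0 <= s <= s0 ->
     l <= Q s ^ 2 + (4 - kappa) * tan_half s * Q s + kappa * dQ s) ->
  kappa * ln (h s0) <= W s0.
Proof.
  intros Hk Hl Hode Hs0 HD W0 Q0 HR.
  assert (Hh : forall s, 0 <= s <= s0 -> 1 <= h s).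
  { intros s Hs. apply (radial_ode_ge_1 kappa l h h1); auto; lra. }
  assert (Hode' := Hode). destruct Hode' as (H0 & H10 & Hder).
  assert (HV : forall s, 0 <= s <= s0 -> 0 <= Q s * h s - kappa * h1 s).
  { intros s Hs.
    assert (Hle := derive_nonneg_le
      (fun x => (Q x * h x - kappa * h1 x) * exp (W x / kappa) * damping kappa x)
      (fun s => h s / kappa * exp (W s / kappa) * damping kappa s
        * (Q s ^ 2 + (4 - kappa) * tan_half s * Q s + kappa * dQ s - l))
      0 s (proj1 Hs)).
    cbv beta in Hle.
    rewrite W0, H0, H10, damping_0 in Hle.
    replace (0 / kappa) with 0 in Hle by (field; lra). rewrite exp_0 in Hle.
    assert (Hpos : 0 < exp (W s / kappa) * damping kappa s)
      by (apply Rmult_lt_0_compat; apply exp_pos).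
    apply (Rmult_le_reg_l _ _ _ Hpos). rewrite Rmult_0_r.
    apply Rle_trans with ((Q 0 * 1 - kappa * 0) * 1 * 1); [lra|].
    apply Rle_trans with (1 := Hle
      ltac:(intros x Hx; destruct (HD x ltac:(lra)) as [DW DQ];
            apply is_derive_wronskian; auto; lra)
      ltac:(intros x Hx; apply Rmult_le_pos;
            [ apply Rmult_le_pos; [apply Rmult_le_pos|left; apply exp_pos];
              [ apply Rdiv_le_0_compat; [assert (A := Hh x ltac:(lra)); lra|lra]
              | left; apply exp_pos ]
            | assert (A := HR x ltac:(lra)); lra ])).
    lra. }
  assert (Hle : W 0 - kappa * ln (h 0) <= W s0 - kappa * ln (h s0)).
  { apply (derive_nonneg_le (fun x => W x - kappa * ln (h x))
      (fun x => (Q x * h x - kappa * h1 x) / h x)); [lra| |].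
    - intros x Hx. destruct (HD x Hx) as [DW _].
      destruct (Hder x) as [D1 _]; [lra|]. assert (A := Hh x Hx).
      auto_derive; [repeat split; try lra; eexists; eassumption|].
      subst_Derive.
      field. lra.
    - intros x Hx. assert (A := Hh x Hx).
      apply Rdiv_le_0_compat; [now apply HV|lra]. }
  rewrite W0, H0, ln_1 in Hle. lra.
Qed.

(* [V <= V 0 = Q 0] bounds [Q - kappa h1 / h] by [Q 0 exp (- W / kappa)], an
   initial layer whose integral is of order [kappa]. *)
Lemma radial_ode_lower (kappa l s0 K : R) (h h1 W Q dQ : R -> R) :
  0 < kappa < 4 -> 0 <= l -> radial_ode kappa l h h1 -> 0 <= s0 < PI ->
  (forall s, 0 <= s <= s0 -> is_derive W s (Q s) /\ is_derive Q s (dQ s)) ->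
  W 0 = 0 -> 0 <= Q 0 ->
  (forall s, 0 <= s <= s0 -> Q 0 <= K * Q s) ->
  (forall s, 0 <= s <= s0 ->
     Q s ^ 2 + (4 - kappa) * tan_half s * Q s + kappa * dQ s <= l) ->
  0 <= K ->
  W s0 - K * kappa <= kappa * ln (h s0).
Proof.
  intros Hk Hl Hode Hs0 HD W0 Q0 HQ HR HK.
  assert (Hh : forall s, 0 <= s <= s0 -> 1 <= h s).
  { intros s Hs. apply (radial_ode_ge_1 kappa l h h1); auto; lra. }
  assert (Hode' := Hode). destruct Hode' as (H0 & H10 & Hder).
  assert (HV : forall s, 0 <= s <= s0 ->
    (Q s * h s - kappa * h1 s) * exp (W s / kappa) * damping kappa s <= Q 0).
  { intros s Hs.
    assert (Hle := derive_nonneg_le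
      (fun x => - ((Q x * h x - kappa * h1 x) * exp (W x / kappa) * damping kappa x))
      (fun s => - (h s / kappa * exp (W s / kappa) * damping kappa s
        * (Q s ^ 2 + (4 - kappa) * tan_half s * Q s + kappa * dQ s - l)))
      0 s (proj1 Hs)).
    cbv beta in Hle.
    rewrite W0, H0, H10, damping_0 in Hle.
    replace (0 / kappa) with 0 in Hle by (field; lra). rewrite exp_0 in Hle.
    assert (Hgoal := Hle
      ltac:(intros x Hx; destruct (HD x ltac:(lra)) as [DW DQ];
            apply (is_derive_opp (V := R_NormedModule)); apply is_derive_wronskian; auto; lra)
      ltac:(intros x Hx; rewrite Ropp_mult_distr_r; apply Rmult_le_pos;
            [ apply Rmult_le_pos; [apply Rmult_le_pos|left; apply exp_pos];
              [ apply Rdiv_le_0_compat; [assert (A := Hh x ltac:(lra)); lra|lra]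
              | left; apply exp_pos ]
            | assert (A := HR x ltac:(lra)); lra ])).
    lra. }
  (* Since [Q 0 <= K Q], the layer is at most [K Q exp (- W / kappa)], the exact derivative of
     [- K kappa exp (- W / kappa)], whose total increase is at most [K kappa]. *)
  assert (Hle : kappa * ln (h 0) - W 0 - K * kappa * exp (- W 0 / kappa)
              <= kappa * ln (h s0) - W s0 - K * kappa * exp (- W s0 / kappa)).
  { apply (derive_nonneg_le
      (fun x => kappa * ln (h x) - W x - K * kappa * exp (- W x / kappa))
      (fun x => K * Q x * exp (- W x / kappa) - (Q x * h x - kappa * h1 x) / h x));
      [lra| |].
    - intros x Hx. destruct (HD x Hx) as [DW _].
      destruct (Hder x) as [D1 _]; [lra|]. assert (A := Hh x Hx).
      auto_derive; [repeat split; try lra; eexists; eassumption|].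
      subst_Derive.
      change (- W x * / kappa) with (- W x / kappa). field. lra.
    - intros x Hx. assert (A := Hh x Hx). assert (B := HV x Hx).
      assert (C := HQ x Hx).
      assert (E := damping_ge_1 kappa x Hk ltac:(lra)).
      set (X := Q x * h x - kappa * h1 x) in *.
      assert (Ew : exp (- W x / kappa) * exp (W x / kappa) = 1).
      { rewrite <- exp_plus, <- exp_0. f_equal. field. lra. }
      assert (P1 := exp_pos (W x / kappa)). assert (P2 := exp_pos (- W x / kappa)).
      set (ew := exp (W x / kappa)) in *. set (em := exp (- W x / kappa)) in *.
      (* Only [X > 0] needs the layer bound; there [h >= 1] and [damping >= 1] allow both factors to
         be dropped. *)
      destruct (Rle_lt_dec X 0) as [HX|HX].
      + assert (X / h x <= 0).
        { apply Rmult_le_0_r; [lra|]. left. apply Rinv_0_lt_compat. lra. }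
        nra.
      + assert (X / h x <= X) by (apply Rle_div_l; nra).
        assert (X * ew <= Q 0) by nra.
        assert (X = X * ew * em) by (rewrite Rmult_assoc, (Rmult_comm ew), Ew; ring).
        assert (X * ew * em <= K * Q x * em) by (apply Rmult_le_compat_r; lra).
        lra. }
  rewrite W0, H0, ln_1 in Hle.
  replace (- 0 / kappa) with 0 in Hle by (field; lra). rewrite exp_0 in Hle.
  assert (P := exp_pos (- W s0 / kappa)).
  assert (0 <= K * kappa * exp (- W s0 / kappa)).
  { apply Rmult_le_pos; [apply Rmult_le_pos|]; lra. }
  lra.
Qed.

(** * The limiting slope and its primitive *)

(* [slope nu] is the positive root [q] of [q ^ 2 + 4 t q = nu], and [action nu]
   is its primitive vanishing at [0]. *)
Definition slope (nu s : R) : R := sqrt (4 * tan_half s ^ 2 + nu) - 2 * tan_half s.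

Definition dslope (nu s : R) : R :=
  (4 * tan_half s / sqrt (4 * tan_half s ^ 2 + nu) - 2)
  * ((1 + tan_half s ^ 2) / 2).

Definition action (nu s : R) : R :=
  RInt (fun x => sqrt (4 * tan_half x ^ 2 + nu)) 0 s + 4 * ln (cos (s / 2)).

Lemma radicand_nonneg (nu s : R) : 0 <= nu -> 0 <= 4 * tan_half s ^ 2 + nu.
Proof. intros Hnu. assert (H := pow2_ge_0 (tan_half s)). lra. Qed.

Lemma continuous_sqrt_tan (nu s : R) : - PI < s < PI ->
  continuous (fun x => sqrt (4 * tan_half x ^ 2 + nu)) s.
Proof.
  intros Hs.
  apply (continuous_comp (fun x => 4 * tan_half x ^ 2 + nu) sqrt);
    [|apply continuous_sqrt].
  apply (ex_derive_continuous (fun x => 4 * tan_half x ^ 2 + nu)).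
  assert (D := is_derive_tan_half s Hs).
  auto_derive. repeat split; eexists; exact D.
Qed.

Lemma ex_RInt_sqrt_tan (nu a b : R) : - PI < a < PI -> - PI < b < PI ->
  ex_RInt (fun x => sqrt (4 * tan_half x ^ 2 + nu)) a b.
Proof.
  intros Ha Hb. apply (ex_RInt_continuous (V := R_CompleteNormedModule)).
  intros z Hz. apply continuous_sqrt_tan. revert Hz.
  unfold Rmin, Rmax. destruct (Rle_dec a b); lra.
Qed.

Lemma is_derive_action (nu s : R) : - PI < s < PI ->
  is_derive (action nu) s (slope nu s).
Proof.
  intros Hs. assert (Hc := cos_half_pos s Hs).
  assert (D : is_derive (RInt (fun x => sqrt (4 * tan_half x ^ 2 + nu)) 0) s
                (sqrt (4 * tan_half s ^ 2 + nu))).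
  { apply (is_derive_RInt (V := R_NormedModule)
      (fun x => sqrt (4 * tan_half x ^ 2 + nu)) _ 0 s);
      [|now apply continuous_sqrt_tan].
    assert (Hloc : locally s (fun x => - PI < x < PI)).
    { apply (open_and _ _ (open_gt (- PI)) (open_lt PI)). exact Hs. }
    apply filter_imp with (2 := Hloc). intros x Hx.
    apply (RInt_correct (V := R_CompleteNormedModule)).
    apply ex_RInt_sqrt_tan; lra. }
  unfold slope, action.
  set (I := RInt (fun x => sqrt (4 * tan_half x ^ 2 + nu)) 0) in *.
  change (is_derive (fun x => I x + 4 * ln (cos (x / 2))) s
    (sqrt (4 * tan_half s ^ 2 + nu) - 2 * tan_half s)).
  auto_derive; [repeat split; [eexists; exact D|exact Hc]|].
  subst_Derive. unfold tan_half. change (s * / 2) with (s / 2).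
  field. exact (Rgt_not_eq _ _ Hc).
Qed.

Lemma is_derive_slope (nu s : R) : 0 < nu -> - PI < s < PI ->
  is_derive (slope nu) s (dslope nu s).
Proof.
  intros Hnu Hs. assert (D := is_derive_tan_half s Hs).
  assert (Hpos : 0 < 4 * tan_half s ^ 2 + nu)
    by (assert (H := pow2_ge_0 (tan_half s)); lra).
  assert (Hsq := sqrt_lt_R0 _ Hpos).
  unfold slope, dslope.
  auto_derive.
  { repeat split; try (eexists; exact D). exact Hpos. }
  subst_Derive.
  replace (4 * (tan_half s * (tan_half s * 1)) + nu)
    with (4 * tan_half s ^ 2 + nu) by ring.
  field. lra.
Qed.

Lemma action_0 (nu : R) : action nu 0 = 0.
Proof.
  unfold action. rewrite RInt_point. replace (0 / 2) with 0 by field.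
  rewrite cos_0, ln_1. unfold zero; simpl. ring.
Qed.

Lemma slope_quadratic (nu s : R) : 0 <= nu ->
  slope nu s ^ 2 + 4 * tan_half s * slope nu s = nu.
Proof.
  intros Hnu. unfold slope.
  assert (H := sqrt_sqrt _ (radicand_nonneg nu s Hnu)).
  set (r := sqrt (4 * tan_half s ^ 2 + nu)) in *.
  replace ((r - 2 * tan_half s) ^ 2 + 4 * tan_half s * (r - 2 * tan_half s))
    with (r * r - 4 * tan_half s ^ 2) by ring.
  lra.
Qed.

Lemma sqrt_add_le (x y : R) : 0 <= x -> 0 <= y -> sqrt (x + y) <= sqrt x + sqrt y.
Proof.
  intros Hx Hy. assert (H := sqrt_sqrt x Hx). assert (H' := sqrt_sqrt y Hy).
  assert (P := sqrt_pos x). assert (P' := sqrt_pos y).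
  apply Rsqr_incr_0_var; [|lra].
  unfold Rsqr. rewrite sqrt_sqrt by lra. nra.
Qed.

Lemma sqrt_4_sqr (t : R) : 0 <= t -> sqrt (4 * t ^ 2) = 2 * t.
Proof.
  intros Ht. replace (4 * t ^ 2) with ((2 * t) * (2 * t)) by ring.
  apply sqrt_square. lra.
Qed.

Lemma slope_pos (nu s : R) : 0 < nu -> 0 <= s < PI -> 0 < slope nu s.
Proof.
  intros Hnu Hs. assert (Ht := tan_half_nonneg s Hs). unfold slope.
  rewrite <- (sqrt_4_sqr _ Ht). apply Rlt_0_minus, sqrt_lt_1.
  - apply Rmult_le_pos; [lra|apply pow2_ge_0].
  - apply radicand_nonneg; lra.
  - lra.
Qed.

Lemma slope_le_sqrt (nu s : R) : 0 <= nu -> 0 <= s < PI -> slope nu s <= sqrt nu.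
Proof.
  intros Hnu Hs. assert (Ht := tan_half_nonneg s Hs). unfold slope.
  assert (H := sqrt_add_le (4 * tan_half s ^ 2) nu
    ltac:(assert (H := pow2_ge_0 (tan_half s)); lra) Hnu).
  rewrite (sqrt_4_sqr _ Ht) in H. lra.
Qed.

(** Positivity of [slope] means [2 t < sqrt (4 t ^ 2 + nu)], so the first factor of [dslope] lies in
    [[-2, 0]]. *)
Lemma dslope_bounds (nu s : R) : 0 < nu -> 0 <= s < PI ->
  - (1 + tan_half s ^ 2) <= dslope nu s <= 0.
Proof.
  intros Hnu Hs. assert (Ht := tan_half_nonneg s Hs).
  assert (Hp := slope_pos nu s Hnu Hs).
  unfold dslope. unfold slope in Hp.
  set (r := sqrt (4 * tan_half s ^ 2 + nu)) in *.
  assert (H1 : 0 <= 4 * tan_half s / r) by (apply Rdiv_le_0_compat; lra).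
  assert (H2 : 4 * tan_half s / r <= 2) by (apply Rle_div_l; lra).
  assert (H3 := pow2_ge_0 (tan_half s)). split; nra.
Qed.

Lemma slope_decreasing (nu s s0 : R) : 0 < nu -> 0 <= s <= s0 -> s0 < PI ->
  slope nu s0 <= slope nu s.
Proof.
  intros Hnu Hs Hs0. apply Ropp_le_cancel.
  apply (derive_nonneg_le (fun x => - slope nu x) (fun x => - dslope nu x));
    [lra| |].
  - intros x Hx. apply (is_derive_opp (V := R_NormedModule)).
    apply is_derive_slope; lra.
  - intros x Hx. assert (H := dslope_bounds nu x Hnu ltac:(lra)). lra.
Qed.

(** * Asymptotics of [kappa ln h] *)

(** With [Q = slope nu], [slope_quadratic] reduces the Riccati expression to
    [nu - kappa (t Q - Q')]. On [[0, s0]] the bracket is at most [M], so the gap [nu - mu] absorbs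
    it once [kappa M < nu - mu]. *)
Lemma action_upper (mu nu s0 : R) : 0 <= mu < nu -> 0 <= s0 < PI ->
  exists delta, 0 < delta /\
  forall kappa l h h1, 0 < kappa < delta -> 0 <= l <= mu ->
    radial_ode kappa l h h1 -> kappa * ln (h s0) <= action nu s0.
Proof.
  intros Hmu Hs0.
  set (T := tan_half s0). set (M := 1 + T ^ 2 + T * sqrt nu).
  assert (HT : 0 <= T) by now apply tan_half_nonneg.
  assert (Hsq := sqrt_pos nu).
  assert (HM : 0 < M) by (unfold M; nra).
  exists ((nu - mu) / M). split; [apply Rdiv_lt_0_compat; lra|].
  intros kappa l h h1 Hk Hl Hode.
  assert (Hk2 : kappa * M < nu - mu) by (apply Rlt_div_r; lra).
  apply (radial_ode_upper kappa l s0 h h1 (action nu) (slope nu) (dslope nu));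
    try lra; try exact Hode.
  - intros s Hs. split; [apply is_derive_action | apply is_derive_slope]; lra.
  - apply action_0.
  - left. apply slope_pos; lra.
  - intros s Hs.
    assert (Hq := slope_quadratic nu s ltac:(lra)).
    assert (Hd := dslope_bounds nu s ltac:(lra) ltac:(lra)).
    assert (Hp := slope_pos nu s ltac:(lra) ltac:(lra)).
    assert (Hu := slope_le_sqrt nu s ltac:(lra) ltac:(lra)).
    assert (Ht := tan_half_nonneg s ltac:(lra)).
    assert (HtT : tan_half s <= T) by (apply tan_half_le; lra).
    assert (tan_half s * slope nu s <= T * sqrt nu) by (apply Rmult_le_compat; lra).
    assert (tan_half s ^ 2 <= T ^ 2) by (apply pow_incr; lra).
    assert (kappa * (- dslope nu s + tan_half s * slope nu s) <= kappa * M)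
      by (apply Rmult_le_compat_l; unfold M; lra).
    nra.
Qed.

(** Here the correction [- kappa (t Q - Q')] has the favourable sign. Small [kappa] serves to have
    [kappa < 4] and an initial layer below [eta]; [K] is admissible because [slope] decreases in
    [s]. *)
Lemma action_lower (nu s0 eta : R) : 0 < nu -> 0 <= s0 < PI -> 0 < eta ->
  exists delta, 0 < delta /\
  forall kappa l h h1, 0 < kappa < delta -> nu <= l ->
    radial_ode kappa l h h1 -> action nu s0 - eta <= kappa * ln (h s0).
Proof.
  intros Hnu Hs0 Heta.
  assert (P0 := slope_pos nu 0 Hnu ltac:(lra)).
  assert (P1 := slope_pos nu s0 Hnu Hs0).
  set (K := slope nu 0 / slope nu s0).
  assert (HK : 0 < K) by (apply Rdiv_lt_0_compat; lra).
  exists (Rmin 4 (eta / K)). split.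
  { apply Rmin_case; [lra | now apply Rdiv_lt_0_compat]. }
  intros kappa l h h1 Hk Hl Hode.
  assert (Hk4 := Rmin_l 4 (eta / K)). assert (Hk5 := Rmin_r 4 (eta / K)).
  assert (Hk2 : kappa * K < eta) by (apply Rlt_div_r; lra).
  apply Rle_trans with (action nu s0 - K * kappa); [lra|].
  apply (radial_ode_lower kappa l s0 K h h1 (action nu) (slope nu) (dslope nu));
    try lra; try exact Hode.
  - intros s Hs. split; [apply is_derive_action | apply is_derive_slope]; lra.
  - apply action_0.
  - intros s Hs. apply Rle_trans with (K * slope nu s0).
    + unfold K. right. field. lra.
    + apply Rmult_le_compat_l; [lra|]. apply slope_decreasing; lra.
  - intros s Hs.
    assert (Hq := slope_quadratic nu s ltac:(lra)).
    assert (Hd := dslope_bounds nu s ltac:(lra) ltac:(lra)).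
    assert (Hp := slope_pos nu s ltac:(lra) ltac:(lra)).
    assert (Ht := tan_half_nonneg s ltac:(lra)).
    assert (0 <= tan_half s * slope nu s) by (apply Rmult_le_pos; lra).
    assert (0 <= kappa * (tan_half s * slope nu s - dslope nu s))
      by (apply Rmult_le_pos; lra).
    lra.
Qed.

(** Continuity in [nu], down to [nu = 0], from subadditivity of the square root. *)
Lemma action_add_le (nu eps s : R) : 0 <= nu -> 0 <= eps -> 0 <= s < PI ->
  action (nu + eps) s <= action nu s + sqrt eps * s.
Proof.
  intros Hnu Heps Hs. unfold action.
  assert (HI : RInt (fun x => sqrt (4 * tan_half x ^ 2 + (nu + eps))) 0 s
    <= RInt (fun x => sqrt (4 * tan_half x ^ 2 + nu) + sqrt eps) 0 s).
  { apply RInt_le; [lra|apply ex_RInt_sqrt_tan; lra| |].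
    - apply (ex_RInt_plus (V := R_NormedModule)
        (fun x => sqrt (4 * tan_half x ^ 2 + nu)) (fun _ => sqrt eps));
        [apply ex_RInt_sqrt_tan; lra | apply ex_RInt_const].
    - intros x Hx. rewrite <- Rplus_assoc.
      apply sqrt_add_le; [now apply radicand_nonneg|exact Heps]. }
  rewrite (RInt_plus (V := R_CompleteNormedModule)
    (fun x => sqrt (4 * tan_half x ^ 2 + nu)) (fun _ => sqrt eps)) in HI;
    [|apply ex_RInt_sqrt_tan; lra | apply ex_RInt_const].
  rewrite RInt_const in HI. unfold plus, scal in HI; simpl in HI.
  unfold mult in HI; simpl in HI. simpl. lra.
Qed.

Lemma action_at_0 (s : R) : 0 <= s < PI -> action 0 s <= 0.
Proof.
  intros Hs. apply Ropp_le_cancel. rewrite Ropp_0.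
  replace 0 with (- action 0 0) at 1 by (rewrite action_0; ring).
  apply (derive_nonneg_le (fun x => - action 0 x) (fun x => - slope 0 x)); [lra| |].
  - intros x Hx. apply (is_derive_opp (V := R_NormedModule)).
    apply is_derive_action; lra.
  - intros x Hx. assert (H := slope_le_sqrt 0 x (Rle_refl 0) ltac:(lra)).
    rewrite sqrt_0 in H. lra.
Qed.

Lemma radial_asymptotics (lambda s0 eta : R) :
  0 <= lambda -> 0 <= s0 < PI -> 0 < eta ->
  exists delta, 0 < delta /\
  forall kappa l h h1, 0 < kappa < delta -> 0 <= l ->
    Rabs (l - 2 * lambda) < delta -> radial_ode kappa l h h1 ->
    Rabs (kappa * ln (h s0) - action (2 * lambda) s0) < eta.
Proof.
  intros Hlam Hs0 Heta.
  (* Raising [nu] by [r * r] raises [action] by at most [r * s0 < eta / 2]. *)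
  set (r := eta / (2 * (s0 + 1))).
  assert (Hr : 0 < r) by (apply Rdiv_lt_0_compat; lra).
  assert (Hrs : r * s0 < eta / 2).
  { replace (eta / 2) with (r * (s0 + 1)) by (unfold r; field; lra). nra. }
  assert (Heps : 0 < r * r) by nra.
  destruct (action_upper (2 * lambda + r * r / 2) (2 * lambda + r * r) s0)
    as [d1 [Hd1 Hup]]; [lra|exact Hs0|].
  assert (Hlow : exists d2, 0 < d2 /\
    forall kappa l h h1, 0 < kappa < d2 -> 0 <= l ->
      Rabs (l - 2 * lambda) < d2 -> radial_ode kappa l h h1 ->
      action (2 * lambda) s0 - eta < kappa * ln (h s0)).
  (* For [lambda = 0] no positive [nu] lies below [2 lambda]; instead [h >= 1] gives [ln h >= 0],
     while [action 0 <= 0]. Otherwise [eps <= lambda] keeps [2 lambda - eps] positive. *)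
  { destruct (Req_dec lambda 0) as [->|Hne].
    - exists 1. split; [lra|]. intros kappa l h h1 Hk Hl _ Hode.
      assert (H1 := radial_ode_ge_1 kappa l h h1 s0 (proj1 Hk) Hl Hode Hs0).
      assert (H2 : 0 <= ln (h s0)) by (rewrite <- ln_1; apply ln_le; lra).
      assert (H3 := action_at_0 s0 Hs0). rewrite Rmult_0_r. nra.
    - set (eps := Rmin (r * r) lambda).
      assert (He1 : eps <= r * r) by apply Rmin_l.
      assert (He2 : eps <= lambda) by apply Rmin_r.
      assert (He0 : 0 < eps) by (apply Rmin_case; lra).
      destruct (action_lower (2 * lambda - eps) s0 (eta / 2))
        as [d2 [Hd2 Hlo]]; [lra|exact Hs0|lra|].
      exists (Rmin d2 eps). split; [now apply Rmin_case|].
      intros kappa l h h1 Hk Hl Hll Hode.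
      assert (M1 := Rmin_l d2 eps). assert (M2 := Rmin_r d2 eps).
      apply Rabs_def2 in Hll.
      assert (H := Hlo kappa l h h1 ltac:(lra) ltac:(lra) Hode).
      assert (H' := action_add_le (2 * lambda - eps) eps s0 ltac:(lra) ltac:(lra) Hs0).
      replace (2 * lambda - eps + eps) with (2 * lambda) in H' by ring.
      assert (sqrt eps <= r).
      { rewrite <- (sqrt_square r) by lra. apply sqrt_le_1; lra. }
      nra. }
  destruct Hlow as [d2 [Hd2 Hlow]].
  set (d := Rmin (Rmin d1 d2) (r * r / 2)).
  assert (M1 : d <= Rmin d1 d2) by apply Rmin_l.
  assert (M2 : d <= r * r / 2) by apply Rmin_r.
  assert (M3 := Rmin_l d1 d2). assert (M4 := Rmin_r d1 d2).
  exists d. split; [unfold d; repeat apply Rmin_case; lra|].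
  intros kappa l h h1 Hk Hl Hll Hode.
  assert (H1 := Hlow kappa l h h1 ltac:(lra) Hl ltac:(lra) Hode).
  apply Rabs_def2 in Hll.
  assert (H2 := Hup kappa l h h1 ltac:(lra) ltac:(lra) Hode).
  assert (H3 := action_add_le (2 * lambda) (r * r) s0 ltac:(lra) ltac:(lra) Hs0).
  rewrite sqrt_square in H3 by lra.
  apply Rabs_def1; lra.
Qed.

(** * Change of variables from [u] to [s], and existence of [phi] *)

(** Passing the derivatives as functions covers both the explicit series and the chosen [phi] with
    its [Derive]. Positivity is left out since it is derived below for [alpha <= 0]. *)
Definition phi_ode (kappa alpha : R) (f f1 f2 : R -> R) : Prop :=
  f (1 / 2) = 1 /\ f1 (1 / 2) = 0 /\
  forall u, 0 < u < 1 ->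
    is_derive f u (f1 u) /\ is_derive f1 u (f2 u) /\
    u * (1 - u) * f2 u - (3 * kappa - 8) / (2 * kappa) * (2 * u - 1) * f1 u
    + 8 * alpha / kappa * f u = 0.

Lemma sin_half_bounds (s : R) : - PI < s < PI -> - 1 < sin (s / 2) < 1.
Proof.
  intros Hs. assert (Hc := cos_half_pos s Hs).
  assert (H := sin2_cos2 (s / 2)). unfold Rsqr in H. split; nra.
Qed.

(* [(1 - sin (s / 2)) / 2 = sin ((PI - s) / 4) ^ 2] *)
Lemma radial_ode_of_phi_ode (kappa alpha : R) (f f1 f2 : R -> R) :
  0 < kappa -> phi_ode kappa alpha f f1 f2 ->
  radial_ode kappa (- 2 * alpha * kappa)
    (fun s => f ((1 - sin (s / 2)) / 2))
    (fun s => - (cos (s / 2) / 4) * f1 ((1 - sin (s / 2)) / 2)).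
Proof.
  intros Hk (H0 & H10 & Hode).
  assert (E0 : (1 - sin (0 / 2)) / 2 = 1 / 2).
  { replace (0 / 2) with 0 by field. rewrite sin_0. field. }
  split; [|split].
  - now rewrite E0.
  - rewrite E0, H10. ring.
  - intros s Hs. assert (Hb := sin_half_bounds s Hs).
    assert (Hc := cos_half_pos s Hs).
    destruct (Hode ((1 - sin (s / 2)) / 2)) as (D1 & D2 & Heq); [lra|].
    split.
    + auto_derive; [repeat split; eexists; exact D1|].
      change ((1 + - sin (s * / 2)) * / 2) with ((1 - sin (s / 2)) / 2).
      subst_Derive. change (s * / 2) with (s / 2). field.
    + auto_derive; [repeat split; eexists; exact D2|].
      change ((1 + - sin (s * / 2)) * / 2) with ((1 - sin (s / 2)) / 2).
      subst_Derive. change (s * / 2) with (s / 2).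
      unfold tan_half.
      assert (Hsc := sin2_cos2 (s / 2)). unfold Rsqr in Hsc.
      set (u := (1 - sin (s / 2)) / 2) in *.
      set (c := cos (s / 2)) in *.
      assert (Hu : u * (1 - u) = c ^ 2 / 4).
      { unfold u. replace (c ^ 2) with (1 - sin (s / 2) * sin (s / 2)) by lra. field. }
      assert (Hu2 : 2 * u - 1 = - sin (s / 2)) by (unfold u; field).
      rewrite Hu, Hu2 in Heq. set (x := sin (s / 2)) in *.
      assert (Heq' : c ^ 2 / 4 * f2 u = - ((3 * kappa - 8) / (2 * kappa) * x * f1 u)
        - 8 * alpha / kappa * f u) by lra.
      (* The difference of the two sides is a quarter of the left side of the equation for [f] at
         [u]. *)
      apply Rminus_diag_uniq.
      transitivity (c ^ 2 / 4 * f2 u / 4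
        - (- ((3 * kappa - 8) / (2 * kappa) * x * f1 u)
           - 8 * alpha / kappa * f u) / 4).
      * field. split; [lra|exact (Rgt_not_eq _ _ Hc)].
      * rewrite Heq'. field. lra.
Qed.

Lemma radial_ode_reflect (kappa l : R) (h h1 : R -> R) :
  radial_ode kappa l h h1 ->
  radial_ode kappa l (fun s => h (- s)) (fun s => - h1 (- s)).
Proof.
  intros (H0 & H10 & Hode). split; [|split].
  - now rewrite Ropp_0.
  - rewrite Ropp_0, H10. ring.
  - intros s Hs. destruct (Hode (- s)) as [D1 D2]; [lra|]. split.
    + auto_derive; [repeat split; eexists; exact D1|].
      subst_Derive. ring.
    + assert (Ht : tan_half (- s) = - tan_half s).
      { unfold tan_half. replace (- s / 2) with (- (s / 2)) by field.
        rewrite sin_neg, cos_neg. unfold Rdiv. ring. }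
      rewrite Ht in D2.
      auto_derive; [repeat split; eexists; exact D2|].
      subst_Derive. ring.
Qed.

Lemma phi_ode_pos (kappa alpha : R) (f f1 f2 : R -> R) (u : R) :
  0 < kappa -> alpha <= 0 -> phi_ode kappa alpha f f1 f2 -> 0 < u < 1 -> 0 < f u.
Proof.
  intros Hk Ha Hf Hu.
  assert (Hode := radial_ode_of_phi_ode _ _ _ _ _ Hk Hf).
  assert (Hl : 0 <= - 2 * alpha * kappa) by nra.
  assert (Hb := asin_bound_lt (1 - 2 * u) ltac:(lra)).
  (* The inverse of [u = (1 - sin (s / 2)) / 2]; a negative [s] is handled by reflection. *)
  set (s := 2 * asin (1 - 2 * u)).
  assert (Hs : (1 - sin (s / 2)) / 2 = u).
  { unfold s. replace (2 * asin (1 - 2 * u) / 2) with (asin (1 - 2 * u)) by field.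
    rewrite sin_asin by lra. field. }
  destruct (Rle_lt_dec 0 s) as [Hpos|Hneg].
  - assert (H := radial_ode_ge_1 _ _ _ _ s Hk Hl Hode ltac:(unfold s in *; lra)).
    cbv beta in H. rewrite Hs in H. lra.
  - assert (H := radial_ode_ge_1 _ _ _ _ (- s) Hk Hl (radial_ode_reflect _ _ _ _ Hode)
      ltac:(unfold s in *; lra)).
    cbv beta in H. rewrite Ropp_involutive, Hs in H. lra.
Qed.

(** In [x = 2 u - 1] the equation reads [(1 - x ^ 2) f'' + (8 / kappa - 3) x f' + (8 alpha / kappa)
    f = 0], which fixes the parameters [d] and [b]. *)
Lemma phi_ode_hyp (kappa alpha : R) : 0 < kappa ->
  let g := hyp (8 / kappa - 2) (- (8 * alpha / kappa)) in
  let g1 := hyp1 (8 / kappa - 2) (- (8 * alpha / kappa)) in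
  let g2 := hyp2 (8 / kappa - 2) (- (8 * alpha / kappa)) in
  phi_ode kappa alpha
    (fun u => g ((2 * u - 1) ^ 2))
    (fun u => 4 * (2 * u - 1) * g1 ((2 * u - 1) ^ 2))
    (fun u => 8 * g1 ((2 * u - 1) ^ 2)
              + 16 * (2 * u - 1) ^ 2 * g2 ((2 * u - 1) ^ 2)).
Proof.
  intros Hk g g1 g2.
  assert (E0 : 2 * (1 / 2) - 1 = 0) by field.
  split; [|split].
  - rewrite E0. replace (0 ^ 2) with 0 by ring. apply hyp_0.
  - rewrite E0. ring.
  - intros u Hu.
    assert (Hv : Rabs ((2 * u - 1) ^ 2) < 1).
    { rewrite Rabs_pos_eq by apply pow2_ge_0. nra. }
    assert (D1 : is_derive g _ _) by (apply is_derive_hyp; exact Hv).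
    assert (D2 : is_derive g1 _ _) by (apply is_derive_hyp1; exact Hv).
    assert (Heq := hyp_ode (8 / kappa - 2) (- (8 * alpha / kappa)) _ Hv).
    fold g g1 g2 in D1, D2, Heq.
    assert (Ev : (2 * u + - (1)) * ((2 * u + - (1)) * 1) = (2 * u - 1) ^ 2) by ring.
    split; [|split].
    + auto_derive; rewrite Ev; [repeat split; eexists; exact D1|].
      subst_Derive. ring.
    + auto_derive; rewrite Ev; [repeat split; eexists; exact D2|].
      subst_Derive. ring.
    + rewrite <- Heq. field. lra.
Qed.

Lemma phi_solution_exists (kappa alpha : R) : 0 < kappa -> alpha <= 0 ->
  exists f, phi_solution kappa alpha f.
Proof.
  intros Hk Ha.
  assert (Hf := phi_ode_hyp kappa alpha Hk). cbv zeta in Hf.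
  match type of Hf with phi_ode _ _ ?a ?b ?c =>
    set (f := a) in *; set (f1 := b) in *; set (f2 := c) in * end.
  assert (Hpos := fun u => phi_ode_pos kappa alpha f f1 f2 u Hk Ha Hf).
  destruct Hf as (H0 & H10 & Hode).
  assert (D1 : forall u, 0 < u < 1 -> Derive f u = f1 u).
  { intros u Hu. apply is_derive_unique. now apply Hode. }
  assert (D2 : forall u, 0 < u < 1 -> is_derive (Derive f) u (f2 u)).
  { intros u Hu. apply is_derive_ext_loc with f1; [|now apply Hode].
    assert (Hloc : locally u (fun x => 0 < x < 1)).
    { apply (open_and _ _ (open_gt 0) (open_lt 1)). exact Hu. }
    apply filter_imp with (2 := Hloc). intros x Hx. now rewrite D1. }
  exists f. repeat split.
  - destruct (Hode u H) as [D _]. eexists; exact D.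
  - eexists; now apply D2.
  - intros u Hu. destruct (Hode u Hu) as (_ & _ & Heq).
    change (Derive_n f 2 u) with (Derive (Derive f) u).
    rewrite (is_derive_unique _ _ _ (D2 u Hu)), D1 by exact Hu. exact Heq.
  - exact H0.
  - rewrite D1 by lra. exact H10.
  - exact Hpos.
Qed.

Lemma phi_spec (kappa alpha : R) : 0 < kappa -> alpha <= 0 ->
  phi_solution kappa alpha (phi kappa alpha).
Proof. intros Hk Ha. unfold phi. now apply epsilon_spec, phi_solution_exists. Qed.

Lemma phi_solution_ode (kappa alpha : R) (f : R -> R) :
  phi_solution kappa alpha f ->
  phi_ode kappa alpha f (Derive f) (Derive (Derive f)).
Proof.
  intros (Hex & Heq & H0 & H10 & _). split; [exact H0|split; [exact H10|]].
  intros u Hu. destruct (Hex u Hu) as [E1 E2].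
  split; [now apply Derive_correct|split; [now apply Derive_correct|]].
  now apply Heq.
Qed.

(** * Passage to the limit [kappa -> 0+] *)

Lemma at_right_0_lt (delta : R) : 0 < delta ->
  at_right 0 (fun kappa => 0 < kappa < delta).
Proof.
  intros Hd. exists (mkposreal delta Hd). intros y Hy Hpos.
  change (Rabs (y - 0) < delta) in Hy. apply Rabs_def2 in Hy. lra.
Qed.

Lemma filterlim_at_right_0 (F : R -> R) (L : R) :
  (forall eps, 0 < eps -> at_right 0 (fun kappa => Rabs (F kappa - L) < eps)) ->
  filterlim F (at_right 0) (locally L).
Proof.
  intros H P [eps HP]. unfold filtermap.
  apply filter_imp with (2 := H eps (cond_pos eps)). intros x Hx. apply HP. exact Hx.
Qed.

Lemma alpha_equiv_scaled (lambda : R) (alpha : R -> R) (delta : R) :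
  0 <= lambda -> alpha_equiv lambda alpha -> 0 < delta ->
  at_right 0 (fun kappa => 0 <= - 2 * alpha kappa * kappa /\
    Rabs (- 2 * alpha kappa * kappa - 2 * lambda) < delta).
Proof.
  intros Hlam Heq Hd.
  (* With [l = - 2 alpha kappa], equivalence gives [Rabs (l - 2 lambda) <= q * Rabs l]. Then
     [q <= 1 / 2] forces [0 <= l <= 4 lambda], and the other bound on [q] makes the error less than
     [delta]. *)
  set (q := Rmin (1 / 2) (delta / (4 * lambda + 1))).
  assert (Hq : 0 < q).
  { apply Rmin_case; [lra|]. apply Rdiv_lt_0_compat; lra. }
  assert (Hq1 : q <= 1 / 2) by apply Rmin_l.
  assert (Hq2 : q * (4 * lambda + 1) <= delta).
  { apply Rle_div_r; [lra|]. apply Rmin_r. }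
  apply filter_imp with
    (2 := filter_and _ _ (Heq (mkposreal q Hq)) (at_right_0_lt 1 Rlt_0_1)).
  intros kappa [H Hk].
  change (Rabs (alpha kappa - - (lambda / kappa)) <= q * Rabs (alpha kappa)) in H.
  set (l := - 2 * alpha kappa * kappa).
  assert (Hl : Rabs (l - 2 * lambda) <= q * Rabs l).
  { replace (l - 2 * lambda)
      with (- (2 * kappa) * (alpha kappa - - (lambda / kappa)))
      by (unfold l; field; lra).
    replace l with (- (2 * kappa) * alpha kappa) by (unfold l; ring).
    rewrite !Rabs_mult, Rabs_Ropp, (Rabs_pos_eq (2 * kappa)) by lra. nra. }
  assert (Hl0 : 0 <= l).
  { apply Rnot_lt_le. intros Hneg. rewrite (Rabs_left l) in Hl by lra.
    rewrite Rabs_left in Hl by lra. nra. }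
  split; [exact Hl0|].
  rewrite (Rabs_pos_eq l) in Hl by lra.
  assert (Hl4 : l <= 4 * lambda).
  { assert (H2 := Rle_abs (l - 2 * lambda)). nra. }
  nra.
Qed.

Lemma ln_calZ (kappa alpha theta1 theta2 : R) : 0 < kappa ->
  0 < phi kappa alpha (sin ((theta2 - theta1) / 4) ^ 2) ->
  kappa * ln (calZ kappa alpha theta1 theta2)
  = (kappa - 6) * ln (sin ((theta2 - theta1) / 2))
    + kappa * ln (phi kappa alpha (sin ((theta2 - theta1) / 4) ^ 2)).
Proof.
  intros Hk Hphi. unfold calZ, Rpower.
  rewrite ln_mult, ln_exp by (exact Hphi || apply exp_pos). field. lra.
Qed.

Lemma sin_quarter_sqr (theta : R) :
  sin (theta / 4) ^ 2 = (1 - sin ((PI - theta) / 2)) / 2.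
Proof.
  replace ((PI - theta) / 2) with (PI / 2 - 2 * (theta / 4)) by field.
  rewrite sin_shift, cos_2a_sin. field.
Qed.

(** The [- 6] is the limit of [kappa - 6] from the sine prefactor; the absolute value sends both
    halves of the range of [theta] to [s >= 0]. *)
Definition limit_potential (lambda theta : R) : R :=
  - 6 * ln (sin (theta / 2)) + action (2 * lambda) (Rabs (PI - theta)).

Lemma radial_phi (kappa alpha theta : R) : 0 < kappa -> alpha <= 0 ->
  exists h h1, radial_ode kappa (- 2 * alpha * kappa) h h1 /\
    h (Rabs (PI - theta)) = phi kappa alpha (sin (theta / 4) ^ 2).
Proof.
  intros Hk Ha.
  assert (Hode := radial_ode_of_phi_ode _ _ _ _ _ Hk
    (phi_solution_ode _ _ _ (phi_spec kappa alpha Hk Ha))).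
  destruct (Rle_lt_dec theta PI) as [Hle|Hlt].
  - eexists _, _. split; [exact Hode|]. cbv beta.
    rewrite Rabs_pos_eq by lra. now rewrite sin_quarter_sqr.
  - eexists _, _. split; [exact (radial_ode_reflect _ _ _ _ Hode)|]. cbv beta.
    rewrite Rabs_left, Ropp_involutive by lra. now rewrite sin_quarter_sqr.
Qed.

Lemma calZ_limit (lambda : R) (alpha : R -> R) (theta1 theta2 : R) :
  0 <= lambda -> alpha_equiv lambda alpha -> theta1 < theta2 < theta1 + 2 * PI ->
  filterlim (fun kappa => kappa * ln (calZ kappa (alpha kappa) theta1 theta2))
    (at_right 0) (locally (limit_potential lambda (theta2 - theta1))).
Proof.
  intros Hlam Heq Hth.
  set (theta := theta2 - theta1). set (s0 := Rabs (PI - theta)).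
  assert (Hs0 : 0 <= s0 < PI).
  { split; [apply Rabs_pos|]. apply Rabs_def1; unfold theta; lra. }
  apply filterlim_at_right_0. intros eps Heps.
  destruct (radial_asymptotics lambda s0 (eps / 2)) as [d [Hd Has]]; try lra.
  set (c := Rabs (ln (sin (theta / 2)))).
  assert (Hc : 0 <= c) by apply Rabs_pos.
  (* The prefactor contributes the error [kappa * ln (sin (theta / 2))]; this bound keeps it below
     [eps / 2]. *)
  set (d' := Rmin d (eps / (2 * (c + 1)))).
  assert (Hd' : 0 < d').
  { apply Rmin_case; [lra|]. apply Rdiv_lt_0_compat; lra. }
  assert (M1 : d' <= d) by apply Rmin_l.
  assert (M2 : d' * (2 * (c + 1)) <= eps).
  { apply Rle_div_r; [lra|]. apply Rmin_r. }
  apply filter_imp with (2 := filter_and _ _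
    (alpha_equiv_scaled lambda alpha d Hlam Heq Hd) (at_right_0_lt d' Hd')).
  intros kappa [[Hl Hll] Hk].
  assert (Ha : alpha kappa <= 0) by nra.
  destruct (radial_phi kappa (alpha kappa) theta (proj1 Hk) Ha)
    as (h & h1 & Hode & Hh).
  fold s0 in Hh.
  assert (Hge := radial_ode_ge_1 _ _ _ _ s0 (proj1 Hk) Hl Hode Hs0).
  assert (Hconv := Has kappa _ _ _ ltac:(lra) Hl Hll Hode).
  rewrite ln_calZ; fold theta; [|lra|rewrite <- Hh; lra].
  rewrite <- Hh. unfold limit_potential. fold s0.
  replace ((kappa - 6) * ln (sin (theta / 2)) + kappa * ln (h s0) -
    (- 6 * ln (sin (theta / 2)) + action (2 * lambda) s0))
    with (kappa * ln (sin (theta / 2))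
          + (kappa * ln (h s0) - action (2 * lambda) s0)) by ring.
  eapply Rle_lt_trans; [apply Rabs_triang|].
  rewrite Rabs_mult, (Rabs_pos_eq kappa) by lra. fold c.
  assert (kappa * c <= d' * c) by (apply Rmult_le_compat_r; lra).
  nra.
Qed.

Lemma limit_potential_sym (lambda theta : R) :
  limit_potential lambda theta = limit_potential lambda (2 * PI - theta).
Proof.
  unfold limit_potential.
  replace ((2 * PI - theta) / 2) with (PI - theta / 2) by field.
  rewrite sin_PI_x.
  replace (PI - (2 * PI - theta)) with (- (PI - theta)) by ring.
  now rewrite Rabs_Ropp.
Qed.

(** At [s = PI - theta] the term [4 ln (cos (s / 2))] of [action] equals [4 ln (sin (theta / 2))],
    turning [- 6] into [- 2]; the substitution [u = PI - x] turns the tangent into a cotangent. *)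
Lemma limit_potential_formula (lambda theta : R) : 0 < theta <= PI ->
  limit_potential lambda theta
  = - 2 * ln (sin (theta / 2))
    + RInt (fun u => sqrt (2 * lambda + 4 * cot (u / 2) ^ 2)) theta PI.
Proof.
  intros Hth. unfold limit_potential, action. rewrite Rabs_pos_eq by lra.
  replace ((PI - theta) / 2) with (PI / 2 - theta / 2) by field.
  rewrite cos_shift.
  set (f := fun x => sqrt (4 * tan_half x ^ 2 + 2 * lambda)).
  assert (Hint : RInt f 0 (PI - theta)
    = RInt (fun u => sqrt (2 * lambda + 4 * cot (u / 2) ^ 2)) theta PI).
  { assert (Hex : ex_RInt f (PI - theta) 0) by (apply ex_RInt_sqrt_tan; lra).
    assert (Hlin := RInt_comp_lin f (-1) PI theta PI).
    replace (-1 * theta + PI) with (PI - theta) in Hlin by ring.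
    replace (-1 * PI + PI) with 0 in Hlin by ring.
    specialize (Hlin Hex).
    rewrite <- (opp_RInt_swap (V := R_CompleteNormedModule)) by exact Hex.
    rewrite <- Hlin, <- (RInt_opp (V := R_CompleteNormedModule)).
    - apply (RInt_ext (V := R_CompleteNormedModule)). intros u _.
      unfold opp, scal, f; simpl. unfold mult; simpl.
      unfold tan_half, cot.
      replace ((-1 * u + PI) / 2) with (PI / 2 - u / 2) by field.
      rewrite sin_shift, cos_shift.
      replace (4 * (cos (u / 2) / sin (u / 2) * (cos (u / 2) / sin (u / 2) * 1))
        + 2 * lambda)
        with (2 * lambda
          + 4 * (cos (u / 2) / sin (u / 2) * (cos (u / 2) / sin (u / 2) * 1)))
        by ring.
      ring.
    - apply (ex_RInt_comp_lin (V := R_NormedModule) f (-1) PI theta PI).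
      now replace (-1 * theta + PI) with (PI - theta) by ring;
        replace (-1 * PI + PI) with 0 by ring. }
  rewrite Hint. ring.
Qed.

(** * The limit for [calG] and the conclusion *)

Lemma ln_calG (kappa mu theta1 theta2 : R) : kappa <> 0 ->
  kappa * ln (calG kappa mu theta1 theta2)
  = 2 * ln (sin ((theta2 - theta1) / 2)) + mu * (theta1 + theta2).
Proof.
  intros Hk. unfold calG, Rpower.
  rewrite <- exp_plus, ln_exp. now field.
Qed.

Theorem proposition1p3 :
  (forall theta1 theta2 : R, theta1 < theta2 < theta1 + 2 * PI ->
   forall mu : R,
     filterlim (fun kappa : R => kappa * ln (calG kappa mu theta1 theta2))
       (at_right 0)
       (locally (2 * ln (sin ((theta2 - theta1) / 2))
                 + mu * (theta1 + theta2))))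
  /\
  (forall lambda : R, 0 <= lambda ->
   exists U : R -> R,
     (forall alpha : R -> R,
        (forall kappa : R, 0 < kappa < 8 -> alpha kappa < 1 - kappa / 8) ->
        alpha_equiv lambda alpha ->
        forall theta1 theta2 : R, theta1 < theta2 < theta1 + 2 * PI ->
          filterlim
            (fun kappa : R => kappa * ln (calZ kappa (alpha kappa) theta1 theta2))
            (at_right 0) (locally (U (theta2 - theta1))))
     /\
     (forall theta : R, 0 < theta <= PI ->
        U theta = U (2 * PI - theta) /\
        U theta = - 2 * ln (sin (theta / 2))
                  + RInt (fun u => sqrt (2 * lambda + 4 * cot (u / 2) ^ 2))
                      theta PI)).
Proof.
  split.
  (* For [kappa > 0] the function is constant in [kappa], equal to its limit. *)
  - intros theta1 theta2 _ mu. apply filterlim_at_right_0. intros eps Heps.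
    apply filter_imp with (2 := at_right_0_lt 1 Rlt_0_1).
    intros kappa Hk. rewrite ln_calG by lra.
    now rewrite Rminus_diag, Rabs_R0.
  - intros lambda Hlam. exists (limit_potential lambda). split.
    + intros alpha _ Heq theta1 theta2 Hth. now apply calZ_limit.
    + intros theta Hth. split.
      * apply limit_potential_sym.
      * now apply limit_potential_formula.
Qed.
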